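(* Let $\alpha>0$, $0<\xi<1$. For all $x,y\in\mathbb{Z}$ and $s\le t$, $$\boldsymbol\Phi_{\alpha,\xi}(s,x;t,y)=\tfrac12(-1)^{\min(x,0)+\max(y,0)}\Big[e^{-\frac12(t-s)}\,\underline K_{\nu(\alpha)-\frac12,-\nu(\alpha)-\frac12,\xi}(t,x+\tfrac12;s,-y+\tfrac12)+e^{\frac12(t-s)}\,\underline K_{\nu(\alpha)+\frac12,-\nu(\alpha)+\frac12,\xi}(t,x-\tfrac12;s,-y-\tfrac12)\Big].$$
   Context: $\nu=\nu(\alpha)=\frac12\sqrt{1-4\alpha}$ (real in $[0,\frac12)$ if $\alpha\le\frac14$, purely imaginary if $\alpha>\frac14$; sign irrelevant). For $x,m\in\mathbb{Z}$, $$\varphi_m(x;\alpha,\xi)=\left(\frac{\Gamma(\frac12+\nu+x)\Gamma(\frac12-\nu+x)}{\Gamma(\frac12+\nu-m)\Gamma(\frac12-\nu-m)}\right)^{\frac12}\xi^{\frac12(x+m)}(1-\xi)^{-m}\,\frac{{}_2F_1(\frac12+\nu+m,\frac12-\nu+m;x+m+1;\frac{\xi}{\xi-1})}{\Gamma(x+m+1)},$$ where ${}_2F_1(A,B;C;w)/\Gamma(C)$ is the regularized Gauss hypergeometric function (entire in $C$; analytically continued in $w\in\mathbb{C}\setminus[1,\infty)$). The extended Pfaffian hypergeometric-type kernel is $$\boldsymbol\Phi_{\alpha,\xi}(s,x;t,y)=(-1)^{\min(x,0)+\max(y,0)}\sum_{m=0}^{\infty}2^{-\delta(m)}e^{-m(t-s)}\varphi_m(x;\alpha,\xi)\varphi_m(-y;\alpha,\xi),\qquad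 x,y\in\mathbb{Z},\ s\le t,$$ $\delta(m)=\delta_{m,0}$. Let $\mathbb{Z}'=\mathbb{Z}+\frac12$ and $\mathbb{Z}'_+$ its positive part. For admissible $z,z'$ (either non-real complex conjugate, or both real in a common interval $(m,m+1)$, $m\in\mathbb{Z}$) and $a,x\in\mathbb{Z}'$, $$\psi_a(x;z,z',\xi)=\left(\frac{\Gamma(x+z+\frac12)\Gamma(x+z'+\frac12)}{\Gamma(-a+z+\frac12)\Gamma(-a+z'+\frac12)}\right)^{\frac12}\xi^{\frac12(x+a)}(1-\xi)^{\frac12(z+z')-a}\,\frac{{}_2F_1(-z+a+\frac12,-z'+a+\frac12;x+a+1;\frac{\xi}{\xi-1})}{\Gamma(x+a+1)}.$$ The extended discrete hypergeometric kernel is, for $x,y\in\mathbb{Z}'$, $$\underline K_{z,z',\xi}(t,x;s,y)=\pm\sum_{a\in\mathbb{Z}'_+}e^{-a|t-s|}\psi_{\pm a}(x;z,z',\xi)\psi_{\pm a}(y;z,z',\xi),$$ with the sign $+$ for $t\ge s$ and $-$ for $t<s$. *)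

(* Defs.v *)
From HB Require Import structures.
From mathcomp Require Import all_boot all_order all_algebra.
From mathcomp Require Import complex.
From mathcomp Require Import all_classical all_reals all_analysis.

Set Implicit Arguments.
Unset Strict Implicit.
Unset Printing Implicit Defensive.

Import Order.TTheory GRing.Theory Num.Theory.
Import numFieldNormedType.Exports.

Local Open Scope classical_set_scope.
Local Open Scope ring_scope.
Local Open Scope complex_scope.

Section SpecialFunctions.
Variable R : realType.
Implicit Types (A B C w z : R[i]) (r : R).

Definition cexp z : R[i] :=
  (expR (complex.Re z))%:C * (cos (complex.Im z) +i* sin (complex.Im z)).

(* R[i]^o is R[i] with the topology of the modulus, as a normed space over
   itself; derivability from R[i]^o to R[i]^o is complex derivability. *)
Definition limC (u : nat -> R[i]) : R[i] := lim ((u : nat -> R[i]^o) @ \oo).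

(* r ^ z for a base r > 0 *)
Definition cpow r z : R[i] := cexp ((ln r)%:C * z).

(* Gauss's formula Gamma(z) = lim_n n! n^z / (z (z + 1) ... (z + n)).  At the
   poles z = 0, -1, -2, ... the quotient is eventually x / 0 = 0, so that
   Gamma z = 0 and (Gamma z)^-1 = 0 there: (Gamma z)^-1 is the entire
   function 1/Gamma at every z. *)
Definition Gamma z : R[i] :=
  limC (fun n : nat =>
    (n`!)%:R * cpow n%:R z / \prod_(0 <= k < n.+1) (z + k%:R)).

Definition pochhammer A (k : nat) : R[i] := \prod_(0 <= j < k) (A + j%:R).

(* 2F1(A, B; C; w) / Gamma(C) = sum_k (A)_k (B)_k / (Gamma(C + k) k!) w^k,
   for |w| < 1 *)
Definition reg2F1_series A B C w : R[i] :=
  limC (fun n : nat => \sum_(0 <= k < n)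
    pochhammer A k * pochhammer B k * (Gamma (C + k%:R))^-1 / (k`!)%:R
      * w ^+ k).

(* The order of R[i] satisfies 1 <= w iff w is real and at least 1, so
   ~~ (1 <= w) says that w is in the plane cut along [1, +oo). *)
Definition is_reg2F1 A B C (F : R[i] -> R[i]) : Prop :=
  (forall w, ~~ (1 <= w) -> derivable (F : R[i]^o -> R[i]^o) w 1) /\
  (forall w, `|w| < 1 -> F w = reg2F1_series A B C w).

(* The value at w of the analytic continuation; it is unique for w in the cut
   plane by the identity theorem. *)
Definition reg2F1 A B C w : R[i] :=
  xget 0 [set v | exists2 F, is_reg2F1 A B C F & F w = v].

End SpecialFunctions.

Section Kernels.
Variable R : realType.
Implicit Types alpha xi s t : R.

Definition nu alpha : R[i] := sqrtC (1 - 4 * alpha%:C) / 2.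

Definition phi (m x : int) alpha xi : R[i] :=
  sqrtC (Gamma (1 / 2 + nu alpha + x%:~R) * Gamma (1 / 2 - nu alpha + x%:~R)
         / (Gamma (1 / 2 + nu alpha - m%:~R)
            * Gamma (1 / 2 - nu alpha - m%:~R)))
  * cpow xi ((x + m)%:~R / 2)
  * cpow (1 - xi) (- m%:~R)
  * reg2F1 (1 / 2 + nu alpha + m%:~R) (1 / 2 - nu alpha + m%:~R)
           (x + m + 1)%:~R (xi / (xi - 1))%:C.

Definition Phi alpha xi s (x : int) t (y : int) : R[i] :=
  (-1) ^ (Num.min x 0 + Num.max y 0)
  * limC (fun n : nat => \sum_(0 <= m < n)
      2 ^- (m == 0%N) * (expR (- m%:R * (t - s)))%:C
      * phi m%:Z x alpha xi * phi m%:Z (- y) alpha xi).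

(* The half-integers a, x of Z + 1/2 are given as elements of R. *)
Definition psi (a x : R) (z z' : R[i]) xi : R[i] :=
  sqrtC (Gamma (x%:C + z + 1 / 2) * Gamma (x%:C + z' + 1 / 2)
         / (Gamma (- a%:C + z + 1 / 2) * Gamma (- a%:C + z' + 1 / 2)))
  * cpow xi ((x + a)%:C / 2)
  * cpow (1 - xi) ((z + z') / 2 - a%:C)
  * reg2F1 (- z + a%:C + 1 / 2) (- z' + a%:C + 1 / 2)
           (x + a + 1)%:C (xi / (xi - 1))%:C.

(* The positive half-integers are a = k + 1/2 for k : nat. *)
Definition Kext (z z' : R[i]) xi t (x : R) s (y : R) : R[i] :=
  let sg : R := if s <= t then 1 else -1 in
  sg%:C * limC (fun n : nat => \sum_(0 <= k < n)
    let a : R := k%:R + 1 / 2 in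
    (expR (- a * `|t - s|))%:C
    * psi (sg * a) x z z' xi * psi (sg * a) y z z' xi).

End Kernels.

(* Main.v *)
(* For z = nu + c and z' = -nu + c with c = -1/2 or c = 1/2, the function
   psi_(m + c)(x - c; z, z') is phi_m(x), the two upper parameters of 2F1 being
   exchanged.  The prefactors e^(c (t - s)) turn the two kernels into the sums
   of T_m = e^(-m (t - s)) phi_m(x) phi_m(-y) over m >= 1 and over m >= 0, and
   half of their total is the sum with the term m = 0 halved.  Convergence is
   not needed: the three series converge or diverge together, and limC is 0 on
   divergent sequences. *)

Require Import Defs.
From mathcomp Require Import all_boot all_order all_algebra.
From mathcomp Require Import complex.
From mathcomp Require Import all_classical all_reals all_analysis.
From mathcomp Require Import ring.

Import Order.TTheory GRing.Theory Num.Theory.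
Import numFieldNormedType.Exports.
Local Open Scope classical_set_scope.
Local Open Scope ring_scope.
Local Open Scope complex_scope.

Definition cvgC (R : realType) (u : nat -> R[i]) : Prop :=
  cvg ((u : nat -> R[i]^o) @ \oo).

Lemma limC_dvg (R : realType) (u : nat -> R[i]) : ~ cvgC R u -> limC u = 0.
Proof. by move=> /dvgP. Qed.

Lemma limC_cvg (R : realType) (u : nat -> R[i]) (l : R[i]) :
  (u : nat -> R[i]^o) @ \oo --> (l : R[i]^o) -> limC u = l.
Proof. by move=> /cvg_lim; apply; exact: norm_hausdorff. Qed.

(** Shifting the index leaves limits unchanged. The relation is asked only from index 1 on: at 0 the
    partial sums are empty, so a difference in the first term does not show there yet. *)
Lemma cvgC_affine {R : realType} (u v : nat -> R[i]) (c b l : R[i]) :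
  (forall n, v n.+1 = c * u n.+1 + b) ->
  (u : nat -> R[i]^o) @ \oo --> (l : R[i]^o) ->
  (v : nat -> R[i]^o) @ \oo --> (c * l + b : R[i]^o).
Proof.
move=> uv ul; rewrite -(cvg_shiftS (v : nat -> R[i]^o)).
rewrite (_ : (fun n => v n.+1) = (fun n => c * u n.+1 + b)); last first.
  by apply/funext => n; exact: uv.
apply: (@cvgD _ R[i]^o); last exact: cvg_cst.
apply: (@cvgM R[i]); first exact: cvg_cst.
by rewrite (cvg_shiftS (u : nat -> R[i]^o)).
Qed.

Lemma limC_scale {R : realType} (u : nat -> R[i]) (c : R[i]) : c != 0 ->
  limC (fun n => c * u n) = c * limC u.
Proof.
move=> c0; have [cu|ncu] := pselect (cvgC R u).
  apply: limC_cvg; rewrite -[c * limC u]addr0.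
  by apply: cvgC_affine cu => n; rewrite addr0.
(* Were [c * u] convergent, so would be [u], on multiplying by [c^-1]. Hence both sequences diverge,
   and both limits take the default value 0. *)
transitivity (0 : R[i]); last by have := limC_dvg _ _ ncu => ->; rewrite mulr0.
apply: limC_dvg => cu; apply: ncu.
apply/cvg_ex; exists (c^-1 * limC (fun n => c * u n) + 0).
by apply: cvgC_affine cu => n; rewrite (mulKf c0) addr0.
Qed.

Lemma limC_half_first {R : realType} (T : nat -> R[i]) :
  limC (fun n => \sum_(0 <= m < n) 2 ^- (m == 0%N) * T m) =
  1 / 2 * (limC (fun n => \sum_(0 <= m < n) T m.+1)
           + limC (fun n => \sum_(0 <= m < n) T m)).
Proof.
set L := fun n => \sum_(0 <= m < n) _.
set S1 := fun n => \sum_(0 <= m < n) T _.+1.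
set S := fun n => \sum_(0 <= m < n) T _.
have SE n : S n.+1 = T 0%N + S1 n by rewrite /S big_nat_recl.
have LE n : L n.+1 = T 0%N / 2 + S1 n.
  rewrite /L big_nat_recl //= expr1 [X in X + _]mulrC; congr (_ + _).
  by apply: eq_bigr => m _; rewrite expr0 invr1 mul1r.
have LS n : L n.+1 = 1 * S n.+1 + - (T 0%N / 2) by rewrite LE SE; field.
have SL n : S n.+1 = 1 * L n.+1 + T 0%N / 2 by rewrite LE SE; field.
have S1S n : S1 n = S n.+1 - T 0%N by rewrite SE; ring.
(* If [S] diverges, so do [L] and [S1], and the claim becomes 0 = 1/2 (0 + 0). *)
have [cS|nS] := pselect (cvgC R S); last first.
  have nL : ~ cvgC R L.
    by move=> cL; apply: nS; apply/cvg_ex; eexists; exact: cvgC_affine SL cL.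
  have nS1 : ~ cvgC R S1.
    move=> c1; apply: nS; apply/cvg_ex; exists (limC S1 + T 0%N).
    rewrite -(cvg_shiftS (S : nat -> R[i]^o)).
    rewrite (_ : (fun n => S n.+1) = (fun n => S1 n + T 0%N)); last first.
      by apply/funext => n; rewrite SE addrC.
    by apply: (@cvgD _ R[i]^o); [exact: c1|exact: cvg_cst].
  rewrite (limC_dvg _ _ nL) (limC_dvg _ _ nS1) (limC_dvg _ _ nS).
  by rewrite addr0 mulr0.
have -> : limC S1 = limC S - T 0%N.
  apply: limC_cvg.
  rewrite (_ : S1 = (fun n => S n.+1 - T 0%N)); last first.
    by apply/funext => n; exact: S1S.
  apply: (@cvgB _ R[i]^o); last exact: cvg_cst.
  by rewrite (cvg_shiftS (S : nat -> R[i]^o)).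
have -> : limC L = 1 * limC S - T 0%N / 2.
  by apply: limC_cvg; exact: cvgC_affine LS cS.
(* With l the limit of [S], this is l - T_0/2 = 1/2 ((l - T_0) + l). *)
by field.
Qed.

Lemma reg2F1_seriesC {R : realType} (A B C w : R[i]) :
  reg2F1_series A B C w = reg2F1_series B A C w.
Proof.
congr limC; apply/funext => n; apply: eq_bigr => k _.
by rewrite (mulrC (pochhammer A k)).
Qed.

Lemma is_reg2F1C {R : realType} (A B C : R[i]) (F : R[i] -> R[i]) :
  is_reg2F1 A B C F -> is_reg2F1 B A C F.
Proof. by move=> [dF sF]; split=> // w w1; rewrite reg2F1_seriesC sF. Qed.

(** Both sides are [xget] of the same set, since a continuation for (A, B) is one for (B, A). *)
Lemma reg2F1C {R : realType} (A B C w : R[i]) : reg2F1 A B C w = reg2F1 B A C w.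
Proof.
congr xget; apply/seteqP.
by split=> v [F FAB Fw]; exists F => //; exact: is_reg2F1C.
Qed.

(** The shift [c] cancels in every argument; for instance (z + z')/2 - a = c - (m + c) = -m. *)
Lemma psi_phi {R : realType} (alpha xi c : R) (m x : int) :
  psi (m%:~R + c) (x%:~R - c) (nu alpha + c%:C) (- nu alpha + c%:C) xi =
  phi m x alpha xi.
Proof.
(* In [psi] the first upper parameter -z + a + 1/2 equals 1/2 - nu + m, which comes second in
   [phi]. *)
rewrite /psi /phi reg2F1C.
have CZ (k : int) : (k%:~R : R)%:C = k%:~R by rewrite rmorph_int.
congr (sqrtC (Gamma _ * Gamma _ / (Gamma _ * Gamma _)) * cpow _ _ * cpow _ _
  * reg2F1 _ _ _ _);
  rewrite ?(rmorphD, rmorphB, rmorphN, rmorph1) /= ?CZ ?(rmorphD, rmorph1) /=;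
  by field.
Qed.

(** Here [d] is the index at which the series in m starts: a = k + 1/2 = (d + k) + c, so that e^(c
    (t - s)) e^(-a (t - s)) = e^(-(d + k) (t - s)). *)
Lemma Kext_phi {R : realType} (alpha xi c s t : R) (x y : int) (d : nat) :
    s <= t -> d%:R + c = 1 / 2 ->
  (expR (c * (t - s)))%:C *
  Kext (nu alpha + c%:C) (- nu alpha + c%:C) xi t (x%:~R - c) s (y%:~R - c) =
  limC (fun n => \sum_(0 <= k < n)
    ((expR (- (d + k)%:R * (t - s)))%:C
     * phi (d + k)%N x alpha xi * phi (d + k)%N y alpha xi)).
Proof.
move=> st dc; rewrite /Kext st; cbv zeta.
(* The exponential prefactor is nonzero, so it may enter the limit even if the series diverges. *)
rewrite (_ : 1%:C = 1 :> R[i]) // [X in _ * X]mul1r -limC_scale; last first.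
  by rewrite (inj_eq (@complexI R)) gt_eqF ?expR_gt0.
congr limC; apply/funext => n; rewrite mulr_sumr; apply: eq_bigr => k _ /=.
have -> : k%:R + 1 / 2 = ((d + k)%N : int)%:~R + c :> R.
  by rewrite -dc -pmulrn natrD; ring.
rewrite mul1r !psi_phi ger0_norm ?subr_ge0 // -pmulrn.
move: (phi _ x _ _) (phi _ y _ _) => P Q.
rewrite !mulrA -rmorphM -expRD /=.
by congr ((expR _)%:C * _ * _); ring.
Qed.

Theorem proposition11p1 (R : realType) (alpha xi : R)
    (halpha : 0 < alpha) (hxi0 : 0 < xi) (hxi1 : xi < 1)
    (x y : int) (s t : R) (hst : s <= t) :
  Phi alpha xi s x t y =
  1 / 2 * (-1) ^ (Num.min x 0 + Num.max y 0) *
  ((expR (- (1 / 2) * (t - s)))%:C *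
     Kext (nu alpha - 1 / 2) (- nu alpha - 1 / 2) xi
          t (x%:~R + 1 / 2) s (- y%:~R + 1 / 2)
   + (expR (1 / 2 * (t - s)))%:C *
     Kext (nu alpha + 1 / 2) (- nu alpha + 1 / 2) xi
          t (x%:~R - 1 / 2) s (- y%:~R - 1 / 2)).
Proof.
have halfC : (1 / 2 : R[i]) = (1 / 2 : R)%:C.
  by rewrite fmorph_div rmorph1 rmorph_nat.
have e1 : 1%:R + - (1 / 2) = 1 / 2 :> R by field.
have e0 : 0%:R + 1 / 2 = 1 / 2 :> R by rewrite add0r.
(* The shift -1/2 forces the start m = 1 and the shift 1/2 the start m = 0, so only the second
   kernel contains the term m = 0. *)
have := Kext_phi alpha xi (- (1 / 2)) s t x (- y) 1 hst e1.
have := Kext_phi alpha xi (1 / 2) s t x (- y) 0 hst e0.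
rewrite !opprK !rmorphN /= -!halfC => -> ->.
rewrite /Phi mulrAC [RHS]mulrC; congr (_ * _).
pose T (m : nat) := (expR (- m%:R * (t - s)))%:C
  * phi m x alpha xi * phi m (- y) alpha xi.
transitivity (limC (fun n => \sum_(0 <= m < n) 2 ^- (m == 0%N) * T m)).
  congr limC; apply/funext => n; apply: eq_bigr => m _; rewrite /T.
  by move: (phi _ x _ _) (phi _ (- y) _ _) => P Q; rewrite !mulrA.
exact: limC_half_first.
Qed.
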